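(* For $\alpha\in\mathbb{N}_0$, $\lambda,\eta,\delta\in\mathbb{C}$ and $n\in\mathbb{N}$, the following relation holds: $${}_{\mathfrak{B}}\mathcal{F}_{n+1}^{(\alpha)}(x_1+1,x_2;\lambda;\eta,\delta)-{}_{\mathfrak{B}}\mathcal{F}_{n+1}^{(\alpha)}(x_1,x_2;\lambda;\eta,\delta)=\sum_{k=0}^{n}\binom{n+1}{k}\,{}_{\mathfrak{B}}\mathcal{F}_k^{(\alpha)}(x_1,x_2;\lambda;\eta,\delta).$$
   Context: $\mathbb{N}$ is the set of natural numbers, $\mathbb{N}_0$ the set of non-negative integers, $\mathbb{C}$ the set of complex numbers; $x_1,x_2$ are variables. For $\alpha\in\mathbb{N}_0$ and $\lambda,\eta,\delta\in\mathbb{C}$, the Bell based Apostol type polynomials ${}_{\mathfrak{B}}\mathcal{F}_n^{(\alpha)}(x_1,x_2;\lambda;\eta,\delta)$ of order $\alpha$ are defined by the generating function $$\sum_{n\ge 0}{}_{\mathfrak{B}}\mathcal{F}_n^{(\alpha)}(x_1,x_2;\lambda;\eta,\delta)\frac{t^n}{n!}=\left(\frac{2^{\eta}t^{\delta}}{\lambda e^{t}+1}\right)^{\alpha}e^{x_1t+x_2(e^t-1)},\qquad |t|<|\log(-\lambda)|.$$ *)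

(* Defs.v *)
From Stdlib Require Import Reals Arith Factorial.
From Coquelicot Require Import Coquelicot.

Local Open Scope C_scope.

Definition Cexp (z : C) : C :=
  ((exp (Re z) * cos (Im z))%R, (exp (Re z) * sin (Im z))%R).

(* Principal argument, with values in (-PI, PI]; meaningful for z <> 0. *)
Definition Carg (z : C) : R :=
  if Rle_dec 0 (Im z) then acos (Re z / Cmod z) else (- acos (Re z / Cmod z))%R.

(* Principal logarithm; meaningful for z <> 0. *)
Definition Clog (z : C) : C := (ln (Cmod z), Carg z).

(* Principal value of z to the complex power w; meaningful for z <> 0. *)
Definition Cpowc (z w : C) : C := Cexp (w * Clog z).

(* |log(-lambda)| as the radius of the disc of validity.  It is the distance
   from 0 to the nearest nonzero zero of lambda * e^t + 1, which fixes the two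
   cases where the principal logarithm does not give it:
   - lambda = 0: no zero at all, hence no restriction on t;
   - lambda = -1: the principal value log 1 = 0 would give an empty disc; as
     usual for Bernoulli-type generating functions the radius is
     |2 i PI| = 2 PI. *)
Definition radius (lam : C) : Rbar :=
  if Ceq_dec lam 0 then p_infty
  else if Ceq_dec lam (-1) then Finite (2 * PI)
  else Finite (Cmod (Clog (- lam))).

Definition bell_apostol_gf (alpha : nat) (lam eta delta x1 x2 t : C) : C :=
  (Cpowc 2 eta * Cpowc t delta / (lam * Cexp t + 1)) ^ alpha
  * Cexp (x1 * t + x2 * (Cexp t - 1)).

(* F n x1 x2 is the n-th Bell based Apostol type polynomial at (x1, x2).
   The expansion is required off t = 0 only: there t^delta and, for
   lambda = -1, the quotient need not be defined, and the value of the sum at 0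
   follows by continuity.  An expansion in nonnegative integer powers of t is
   itself a constraint on the parameters (for instance, when alpha > 0 and
   lambda <> -1, alpha * delta has to be a nonnegative integer). *)
Definition is_bell_apostol (alpha : nat) (lam eta delta : C)
    (F : nat -> C -> C -> C) : Prop :=
  forall x1 x2 t : C, t <> 0 -> Rbar_lt (Cmod t) (radius lam) ->
    is_series (fun n => F n x1 x2 * (t ^ n / INR (fact n)))
      (bell_apostol_gf alpha lam eta delta x1 x2 t).

(* Main.v *)
Require Import Defs.
From Stdlib Require Import Reals Arith.
From Coquelicot Require Import Coquelicot.
From Stdlib Require Import Lra.
Local Open Scope C_scope.

(** Replacing [x1] by [x1 + 1] multiplies the generating function by [e^t], so
    the recurrence is the coefficientwise form of the Cauchy product of
    [sum_k F_k(x1,x2) t^k/k!] with the exponential series; the term [k = n+1]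
    of the resulting binomial sum is the one that the difference cancels.

    To read off coefficients it suffices to let [t] run through the small
    nonzero real numbers.  There [e^t] is real, so the real and the imaginary
    parts of the coefficients satisfy the same relation separately, and the
    claim becomes one on real power series ([egf_mult_exp]).  The expansions
    are only known off [t = 0]; uniqueness of coefficients survives because both
    series may first be multiplied by [t] ([pseries_coeff_unique]).  Finally,
    the disc of validity is never empty ([radius_pos]): the principal logarithm
    vanishes at [1] only, a value at which the radius is [2 PI] instead. *)

(** * Real power series agreeing off the origin *)

Lemma CV_radius_ge (a : nat -> R) (x : R) :
  ex_pseries a x -> Rbar_le (Rabs x) (CV_radius a).
Proof.
  intros [l Hl].
  apply Rbar_not_lt_le; intros Hlt.
  apply (CV_disk_outside a x Hlt), ex_series_lim_0.
  exists l; now apply is_pseries_R.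
Qed.

Lemma CV_radius_gt (a : nat -> R) (r : R) :
  (forall x : R, x <> 0%R -> (Rabs x < r)%R -> ex_pseries a x) ->
  forall x : R, (Rabs x < r)%R -> Rbar_lt (Rabs x) (CV_radius a).
Proof.
  intros Ha x Hx.
  pose proof (Rabs_pos x) as Hx0.
  (* the midpoint of |x| and r is a nonzero point of convergence beyond x *)
  assert (Hm : Rabs ((Rabs x + r) / 2) = ((Rabs x + r) / 2)%R)
    by (apply Rabs_pos_eq; lra).
  apply Rbar_lt_le_trans with (Rabs ((Rabs x + r) / 2)).
  - rewrite Hm; simpl; lra.
  - apply CV_radius_ge, Ha; [lra | rewrite Hm; lra].
Qed.

(** Nothing is assumed at [x = 0]. *)
Lemma pseries_coeff_unique (a b : nat -> R) (r : R) :
  (0 < r)%R ->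
  (forall x : R, x <> 0%R -> (Rabs x < r)%R ->
     exists l : R, is_pseries a x l /\ is_pseries b x l) ->
  forall n : nat, a n = b n.
Proof.
  intros Hr Hab n.
  assert (Ha : Rbar_lt 0 (CV_radius a)).
  { rewrite <- Rabs_R0. apply CV_radius_gt with r; [|now rewrite Rabs_R0].
    intros x Hx0 Hx; destruct (Hab x Hx0 Hx) as [l [H _]]; now exists l. }
  assert (Hb : Rbar_lt 0 (CV_radius b)).
  { rewrite <- Rabs_R0. apply CV_radius_gt with r; [|now rewrite Rabs_R0].
    intros x Hx0 Hx; destruct (Hab x Hx0 Hx) as [l [_ H]]; now exists l. }
  (* a factor x makes both sums vanish at the origin *)
  change (PS_incr_1 a (S n) = PS_incr_1 b (S n)).
  apply PSeries_ext_recip; rewrite ?CV_radius_incr_1; trivial.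
  exists (mkposreal r Hr); intros x Hx.
  rewrite !PSeries_incr_1.
  destruct (Req_dec x 0) as [->|Hx0]; [now rewrite !Rmult_0_l|].
  change (Rabs (x - 0) < r)%R in Hx; rewrite Rminus_0_r in Hx.
  destruct (Hab x Hx0 Hx) as [l [H1 H2]].
  now rewrite (is_pseries_unique _ _ _ H1), (is_pseries_unique _ _ _ H2).
Qed.

(** Multiplying an exponential generating function by [e^x] acts on its
    coefficients as the binomial transform. *)
Lemma egf_mult_exp (f g : nat -> R) (r : R) :
  (0 < r)%R ->
  (forall x : R, x <> 0%R -> (Rabs x < r)%R -> exists l : R,
     is_pseries (fun n => f n / INR (fact n))%R x l /\
     is_pseries (fun n => g n / INR (fact n))%R x (l * exp x)%R) ->
  forall n : nat, g n = sum_n (fun k => Binomial.C n k * f k)%R n.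
Proof.
  intros Hr Hfg n.
  set (a := fun n => (f n / INR (fact n))%R).
  set (e := fun n => (/ INR (fact n))%R).
  assert (Ha : forall x : R, (Rabs x < r)%R -> Rbar_lt (Rabs x) (CV_radius a)).
  { apply CV_radius_gt; intros x Hx0 Hx.
    destruct (Hfg x Hx0 Hx) as [l [H _]]; now exists l. }
  assert (He : forall x : R, Rbar_lt (Rabs x) (CV_radius e)).
  { intros x; apply CV_radius_gt with (Rabs x + 1)%R; [|lra].
    intros y _ _; exists (exp y); apply is_exp_Reals. }
  assert (H : (g n / INR (fact n))%R = PS_mult a e n).
  { apply (pseries_coeff_unique
             (fun n => g n / INR (fact n))%R (PS_mult a e) r Hr).
    intros x Hx0 Hx; destruct (Hfg x Hx0 Hx) as [l [H1 H2]].
    exists (l * exp x)%R; split; [exact H2|].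
    apply is_pseries_mult; auto; apply is_exp_Reals. }
  replace (g n) with (INR (fact n) * (g n / INR (fact n)))%R
    by (field; apply INR_fact_neq_0).
  rewrite H; unfold PS_mult.
  rewrite scal_sum, sum_n_Reals.
  apply sum_eq; intros k _.
  unfold a, e, Binomial.C; field; split; apply INR_fact_neq_0.
Qed.

(** * Real and imaginary parts of complex series *)

Lemma sum_n_Re_Im (u : nat -> C) (n : nat) :
  sum_n u n = (sum_n (fun k => Re (u k)) n, sum_n (fun k => Im (u k)) n).
Proof.
  induction n as [|n IH].
  - rewrite !sum_O; now destruct (u 0%nat).
  - rewrite !sum_Sn, IH; reflexivity.
Qed.

Lemma is_series_Re_Im (u : nat -> C) (l : C) :
  is_series u l ->
  is_series (fun n => Re (u n)) (Re l) /\ is_series (fun n => Im (u n)) (Im l).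
Proof.
  intros H; split; intros P [eps HP].
  - assert (HC : locally (T := C_UniformSpace) l (fun z => P (Re z)))
      by (exists eps; intros z [Hz _]; now apply HP).
    destruct (H _ HC) as [N HN]; exists N; intros n Hn.
    specialize (HN n Hn); now rewrite sum_n_Re_Im in HN.
  - assert (HC : locally (T := C_UniformSpace) l (fun z => P (Im z)))
      by (exists eps; intros z [_ Hz]; now apply HP).
    destruct (H _ HC) as [N HN]; exists N; intros n Hn.
    specialize (HN n Hn); now rewrite sum_n_Re_Im in HN.
Qed.

(** A complex exponential generating function evaluated at a real point. *)
Lemma egf_Re_Im (c : nat -> C) (x : R) (l : C) :
  is_series (fun n => c n * (RtoC x ^ n / INR (fact n))) l ->
  is_pseries (fun n => Re (c n) / INR (fact n))%R x (Re l) /\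
  is_pseries (fun n => Im (c n) / INR (fact n))%R x (Im l).
Proof.
  intros H.
  assert (Hc : forall n, c n * (RtoC x ^ n / INR (fact n)) =
            ((Re (c n) / INR (fact n) * x ^ n)%R,
             (Im (c n) / INR (fact n) * x ^ n)%R)).
  { intros n; rewrite <- RtoC_pow, <- RtoC_div by apply INR_fact_neq_0.
    unfold Re, Im, Cmult, RtoC, fst, snd.
    f_equal; field; apply INR_fact_neq_0. }
  apply (is_series_ext _ _ _ Hc), is_series_Re_Im in H.
  split; apply is_pseries_R; apply H.
Qed.

(** * The disc of validity and the shift of the generating function *)

Lemma Clog_neq_0 (z : C) : z <> 0 -> z <> 1 -> Clog z <> 0.
Proof.
  intros Hz0 Hz1 Hlog.
  injection Hlog as Hln Harg.
  assert (Hm : Cmod z = 1%R)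
    by (apply ln_inv; [now apply Cmod_gt_0 | lra | now rewrite ln_1]).
  pose proof (re_le_Cmod z) as Hre; rewrite Hm in Hre.
  apply Rabs_le_between in Hre.
  assert (Hac : acos (Re z) = 0%R).
  { revert Harg; unfold Carg; rewrite Hm, Rdiv_1_r.
    destruct (Rle_dec 0 (Im z)); lra. }
  assert (Hr1 : Re z = 1%R) by (rewrite <- (cos_acos (Re z)), Hac, cos_0; lra).
  apply Hz1; destruct z as [u v]; simpl in Hr1; subst u.
  unfold Cmod in Hm; simpl in Hm.
  apply (f_equal (fun s => s * s)%R) in Hm.
  rewrite sqrt_sqrt in Hm by nra.
  unfold RtoC; f_equal; nra.
Qed.

Lemma radius_pos (lam : C) : Rbar_lt 0 (radius lam).
Proof.
  unfold radius.
  destruct (Ceq_dec lam 0) as [|H0]; [exact I|].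
  destruct (Ceq_dec lam (-1)) as [|H1]; simpl.
  - pose proof PI_RGT_0; lra.
  - apply Cmod_gt_0, Clog_neq_0; intros H.
    + apply H0; replace lam with (- - lam) by ring; rewrite H; ring.
    + apply H1; replace lam with (- - lam) by ring; rewrite H; ring.
Qed.

Lemma Cexp_plus (z w : C) : Cexp (z + w) = Cexp z * Cexp w.
Proof.
  destruct z as [a b], w as [c d]; unfold Cexp, Cplus, Cmult; simpl.
  rewrite exp_plus, cos_plus, sin_plus; f_equal; ring.
Qed.

Lemma Cexp_RtoC (x : R) : Cexp x = exp x.
Proof.
  unfold Cexp, RtoC; simpl; rewrite cos_0, sin_0; f_equal; ring.
Qed.

Lemma bell_apostol_gf_shift (alpha : nat) (lam eta delta x1 x2 t : C) :
  bell_apostol_gf alpha lam eta delta (x1 + 1) x2 t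
  = bell_apostol_gf alpha lam eta delta x1 x2 t * Cexp t.
Proof.
  unfold bell_apostol_gf.
  replace ((x1 + 1) * t + x2 * (Cexp t - 1))
    with ((x1 * t + x2 * (Cexp t - 1)) + t) by ring.
  rewrite Cexp_plus; ring.
Qed.

(** * The difference equation *)

(** The shift [x1 -> x1 + 1] is the binomial transform of the sequence of
    polynomials, here including the term [k = n]. *)
Lemma bell_apostol_shift (alpha : nat) (lam eta delta : C)
    (F : nat -> C -> C -> C) :
  is_bell_apostol alpha lam eta delta F ->
  forall (x1 x2 : C) (n : nat),
    F n (x1 + 1) x2 = sum_n (fun k => Binomial.C n k * F k x1 x2) n.
Proof.
  intros HF x1 x2 n.
  assert (Hrad : exists r : R, (0 < r)%R /\
            forall x : R, (Rabs x < r)%R -> Rbar_lt (Rabs x) (radius lam)).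
  { pose proof (radius_pos lam) as Hp.
    destruct (radius lam) as [r| |]; [now exists r | | contradiction].
    exists 1%R; split; [lra | now intros]. }
  destruct Hrad as [r [Hr Hrl]].
  assert (HG : forall x : R, x <> 0%R -> (Rabs x < r)%R -> exists l : C,
     is_series (fun k => F k x1 x2 * (RtoC x ^ k / INR (fact k))) l /\
     is_series (fun k => F k (x1 + 1) x2 * (RtoC x ^ k / INR (fact k)))
       (l * exp x)).
  { intros x Hx0 Hx.
    assert (Hx0' : RtoC x <> 0) by (intros H; now apply Hx0, RtoC_inj).
    assert (Hx' : Rbar_lt (Cmod x) (radius lam))
      by (rewrite Cmod_R; now apply Hrl).
    exists (bell_apostol_gf alpha lam eta delta x1 x2 x); split.
    - now apply HF.
    - rewrite <- Cexp_RtoC, <- bell_apostol_gf_shift; now apply HF. }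
  rewrite sum_n_Re_Im.
  transitivity (Re (F n (x1 + 1) x2), Im (F n (x1 + 1) x2));
    [now destruct (F n (x1 + 1) x2)|].
  refine (f_equal2 pair _ _).
  - rewrite (egf_mult_exp (fun k => Re (F k x1 x2))
               (fun k => Re (F k (x1 + 1) x2)) r Hr).
    + apply sum_n_ext; intros k; symmetry; apply re_scal_l.
    + intros x Hx0 Hx; destruct (HG x Hx0 Hx) as [l [H1 H2]].
      apply egf_Re_Im in H1, H2; exists (Re l); split; [apply H1|].
      rewrite <- re_scal_r.
      apply H2.
  - rewrite (egf_mult_exp (fun k => Im (F k x1 x2))
               (fun k => Im (F k (x1 + 1) x2)) r Hr).
    + apply sum_n_ext; intros k; symmetry; apply im_scal_l.
    + intros x Hx0 Hx; destruct (HG x Hx0 Hx) as [l [H1 H2]].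
      apply egf_Re_Im in H1, H2; exists (Im l); split; [apply H1|].
      rewrite <- im_scal_r.
      apply H2.
Qed.

Theorem theorem3p2 :
  forall (alpha : nat) (lam eta delta : C) (F : nat -> C -> C -> C),
    is_bell_apostol alpha lam eta delta F ->
    forall (x1 x2 : C) (n : nat), (1 <= n)%nat ->
      F (S n) (x1 + 1) x2 - F (S n) x1 x2
      = sum_n (fun k => Binomial.C (S n) k * F k x1 x2) n.
Proof.
  intros alpha lam eta delta F HF x1 x2 n _.
  rewrite (bell_apostol_shift _ _ _ _ _ HF), sum_Sn.
  change plus with Cplus.
  assert (HC : Binomial.C (S n) (S n) = 1%R).
  { unfold Binomial.C; rewrite Nat.sub_diag.
    change (INR (fact 0)) with 1%R; field; apply INR_fact_neq_0. }
  rewrite HC; ring.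
Qed.
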